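(* Let $\delta\in(0,1)$, $\alpha>0$, $\rho\in(0,1)$, and $J\in\mathbb{N}$. Let $S_0=0$ and $S_j=S_{j-1}+\delta^{\,j-2^{j-1}}$ for $j=1,\dots,J$. Let $(f_0,f_0',f_0'')=(0,-1/\alpha,0)$ and, for $j=1,\dots,J$, $$(f_j,f_j',f_j'')=\left(-\frac{\rho}{\alpha}\sum_{k=0}^{j-1}\delta^{\,2k+4-2^{k+2}},\ -\frac{\delta^{\,j+2-2^{j+1}}}{\alpha},\ 0\right).$$ Let $\Delta=\frac{1-\delta}{2}$ and let $F_J:\mathbb{R}\to\mathbb{R}$ be the function built from $(S_j)$, $(f_j,f_j',f_j'')$ and $\Delta$ as described in the context. Let $\theta_0=0$ and let $\theta_1,\dots,\theta_J$ be generated by Armijo's backtracking method with parameters $\alpha,\delta,\rho$ (described in the context) applied to $F=F_J$. Then, for each $j=1,\dots,J$, the total number of objective function evaluations taken by the method upon acceptance of the iterate $\theta_j$ is $2^j$.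
   Context: $\dot F,\ddot F$ denote first and second derivatives; $\mathbb{N}=\{1,2,\dots\}$. Construction of $F_J$: given $S_0<\dots<S_J$, triples $(f_j,f_j',f_j'')\in\mathbb{R}^3$ and $\Delta>0$ such that the intervals $[S_j-\Delta,S_j+\Delta]$ are pairwise disjoint, for each $j\in\{0,\dots,J\}$ let $P_j$ be a polynomial of degree $9$ with $P_j,\dot P_j,\ddot P_j$ vanishing at $S_j\pm\Delta$ and $P_j(S_j)=f_j$, $\dot P_j(S_j)=f_j'$, $\ddot P_j(S_j)=f_j''$ (such polynomials exist). Set $F_J(\theta)=P_j(\theta)$ for $\theta\in[S_j-\Delta,S_j+\Delta]$, $j=0,\dots,J$, and $F_J(\theta)=0$ otherwise. Armijo's backtracking method with parameters $\alpha>0$, $\delta,\rho\in(0,1)$ and initial point $\theta_0$: for $k=0,1,2,\dots$, let $\ell$ be the smallest integer $\ell\ge0$ (found by testing $\ell=0,1,2,\dots$ in turn) such that $F(\theta_k-\alpha\delta^\ell\dot F(\theta_k))\le F(\theta_k)-\rho\alpha\delta^\ell|\dot F(\theta_k)|^2$, and set $\theta_{k+1}=\theta_k-\alpha\delta^\ell\dot F(\theta_k)$. Counting convention: one evaluation is counted for $F(\theta_0)$ and one for the value of $F$ at each tested trial point $\theta_k-\alpha\delta^\ell\dot F(\theta_k)$; the value $F(\theta_k)$ for $k\ge1$, already computed when $\theta_k$ was accepted, is not counted again. *)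

(* Defs.v *)
From HB Require Import structures.
From mathcomp Require Export all_boot all_order all_algebra.
From mathcomp Require Export all_classical all_reals all_analysis.
Set Implicit Arguments.
Unset Strict Implicit.
Unset Printing Implicit Defensive.
Export Order.TTheory GRing.Theory Num.Theory.
Export numFieldNormedType.Exports.
Local Open Scope ring_scope.

(* [size p = 10] says that p has degree exactly 9; these nine conditions leave
   one degree of freedom, so p is not unique. *)
Definition interpolates (R : realType) (s Delta : R) (v : R * R * R)
    (p : {poly R}) : Prop :=
  let: (f, f', f'') := v in
  [/\ size p = 10%N,
      (forall x, x = s - Delta \/ x = s + Delta ->
        [/\ p.[x] = 0, (deriv p).[x] = 0 & (deriv (deriv p)).[x] = 0])
    & [/\ p.[s] = f, (deriv p).[s] = f' & (deriv (deriv p)).[s] = f'']].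

(* When the intervals are pairwise disjoint, at most one j can be picked. *)
Definition glue (R : realType) (J : nat) (S : nat -> R) (Delta : R)
    (P : nat -> {poly R}) (theta : R) : R :=
  if [pick j : 'I_J.+1 | S j - Delta <= theta <= S j + Delta] is Some j
  then (P j).[theta] else 0.

(* Exponents are integers and may be negative: [^] is exprz. *)
Fixpoint node (R : realType) (delta : R) (j : nat) : R :=
  if j is i.+1 then node delta i + delta ^ (i.+1%:Z - 2 ^+ i) else 0.

Definition node_data (R : realType) (delta alpha rho : R) (j : nat) :
    R * R * R :=
  if j is 0 then (0, - (1 / alpha), 0)
  else (- (rho / alpha) * \sum_(0 <= k < j)
            delta ^ ((2 * k + 4)%N%:Z - 2 ^+ (k + 2)),
        - (delta ^ ((j + 2)%N%:Z - 2 ^+ (j + 1)) / alpha),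
        0).

Section Armijo.
Context (R : realType) (F : R -> R) (alpha delta rho : R).

Definition trial (theta : R) (l : nat) : R :=
  theta - alpha * delta ^+ l * derive1 F theta.

Definition armijo (theta : R) (l : nat) : Prop :=
  F (trial theta l) <=
    F theta - rho * alpha * delta ^+ l * `|derive1 F theta| ^+ 2.

(* [theta] and [ell] record the iterates and the accepted exponents of the
   first J outer iterations; their values beyond J are irrelevant. *)
Definition armijo_run (theta0 : R) (J : nat)
    (theta : nat -> R) (ell : nat -> nat) : Prop :=
  theta 0%N = theta0 /\
  forall k, (k < J)%N ->
    [/\ armijo (theta k) (ell k),
        (forall l, (l < ell k)%N -> ~ armijo (theta k) l)
      & theta k.+1 = trial (theta k) (ell k)].

End Armijo.

(* One evaluation for F(theta_0), and, for each k < j, one for each of the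
   tested exponents 0, ..., ell k. *)
Definition evaluations (ell : nat -> nat) (j : nat) : nat :=
  (1 + \sum_(0 <= k < j) (ell k).+1)%N.

(* Main.v *)
Require Import Defs.
From mathcomp Require Import zify ring lra.
Set Implicit Arguments.
Unset Strict Implicit.
Unset Printing Implicit Defensive.
Local Open Scope ring_scope.

(** Write [gap j = delta ^ (j + 1 - 2 ^ j)], so that consecutive nodes satisfy
    [S_(j+1) = S_j + gap j].  Everything rests on two features of this sequence.

    - The prescribed slope at [S_k] is [- gap k.+1 / alpha], so the trial points
      from [S_k] are [S_k + delta ^ l * gap k.+1]: the first one overshoots by
      the length of the following gap, and since
      [delta ^ (2 ^ k - 1) * gap k.+1 = gap k] ([gap_backtrack]), exactly
      [2 ^ k - 1] reductions bring the trial point onto [S_(k+1)].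
    - All gaps are at least [1] while the windows around the nodes have
      half-width [(1 - delta) / 2 < 1 / 2].  A trial point with fewer reductions
      lies beyond [S_(k+1)] by at least [gap k * (1 / delta - 1) > 1 - delta],
      and before [S_(k+2)] by at least [gap k >= 1]; hence it misses every window
      and [F] vanishes there ([trial_in_void]).

    The prescribed values are [f_j = - (rho / alpha) * \sum_(k < j) gap k.+1 ^ 2].
    They are nonpositive, whereas the Armijo test asks for a strict decrease, so
    a trial value of [0] is rejected ([armijo_rejected]).  On the other hand
    [f_k - f_(k+1)] is the decrease that the test would require for a step
    [l = 0], which is the most demanding one, so [S_(k+1)] is accepted
    ([armijo_accepted]).  The method therefore visits the nodes in order with
    [2 ^ k] tests in iteration [k], and [1 + \sum_(k < j) 2 ^ k = 2 ^ j]. *)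

(** * Gaps between the nodes *)

Definition gap {R : realType} (delta : R) (j : nat) : R :=
  delta ^ (j.+1%:Z - 2 ^+ j).

Lemma expr2z (n : nat) : 2 ^+ n = (2 ^ n)%N%:Z.
Proof. by rewrite -natz natrX. Qed.

Lemma nodeS (R : realType) (delta : R) (j : nat) :
  node delta j.+1 = node delta j + gap delta j.
Proof. by []. Qed.

Lemma gap_gt0 (R : realType) (delta : R) (j : nat) :
  0 < delta -> 0 < gap delta j.
Proof. by move=> d0; rewrite /gap exprz_gt0. Qed.

(** The exponent of a gap is nonpositive because [j < 2 ^ j]. *)
Lemma gap_ge1 (R : realType) (delta : R) (j : nat) :
  0 < delta < 1 -> 1 <= gap delta j.
Proof.
move=> /andP[d0 d1]; rewrite /gap.
have -> : j.+1%:Z - 2 ^+ j = - (2 ^ j - j.+1)%N%:Z.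
  by rewrite expr2z; have := ltn_expl j (ltnSn 1); lia.
by rewrite -exprnN invf_ge1 ?exprn_gt0 // exprn_ile1 // ltW.
Qed.

(** The exponents of [gap k] and [gap k.+1] differ by
    [(k + 1 - 2 ^ k) - (k + 2 - 2 ^ k.+1) = 2 ^ k - 1]; this difference is the
    number of rejected trial points in iteration [k]. *)
Lemma gap_backtrack (R : realType) (delta : R) (k : nat) :
  0 < delta -> delta ^+ (2 ^ k).-1 * gap delta k.+1 = gap delta k.
Proof.
move=> d0; rewrite /gap (exprnP delta) -expfzDr ?gt_eqF //; congr (_ ^ _).
by rewrite !expr2z expnS; have := expn_gt0 2 k; lia.
Qed.

Lemma node_lt_spread (R : realType) (delta : R) (i j : nat) :
  0 < delta < 1 -> (i < j)%N -> node delta i + 1 <= node delta j.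
Proof.
move=> hd; elim: j => // j IHj; rewrite ltnS leq_eqVlt nodeS.
have g1 := gap_ge1 j hd.
by case/predU1P=> [->|/IHj]; lra.
Qed.

Lemma node_le (R : realType) (delta : R) (i j : nat) :
  0 < delta < 1 -> (i <= j)%N -> node delta i <= node delta j.
Proof.
move=> hd; rewrite leq_eqVlt => /predU1P[-> //|/(node_lt_spread hd)].
by lra.
Qed.

(** * Functions glued from polynomials on disjoint windows *)

Definition window {R : realType} (S : nat -> R) (Delta : R) (j : nat) (x : R) :=
  S j - Delta <= x <= S j + Delta.

Lemma glue_outside (R : realType) J (S : nat -> R) Delta P (x : R) :
  (forall j, (j <= J)%N -> ~~ window S Delta j x) -> glue J S Delta P x = 0.
Proof.
move=> out; rewrite /glue; case: pickP => // j xj.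
by have := out j (ltn_ord j); rewrite /window xj.
Qed.

Lemma glue_inside (R : realType) J (S : nat -> R) Delta P (j : nat) (x : R) :
  (forall i y, window S Delta i y -> window S Delta j y -> i = j) ->
  (j <= J)%N -> window S Delta j x -> glue J S Delta P x = (P j).[x].
Proof.
move=> sep jJ xj; rewrite /glue; case: pickP => [i xi|none].
  by rewrite (sep i x).
have := none (Ordinal (jJ : (j < J.+1)%N)).
by rewrite /= -/(window S Delta j x) xj.
Qed.

(** The centre of a window is interior to it, so the glued function coincides
    with the polynomial of that window near the centre. *)
Lemma derive1_glue (R : realType) J (S : nat -> R) Delta P (j : nat) :
  0 < Delta ->
  (forall i y, window S Delta i y -> window S Delta j y -> i = j) ->
  (j <= J)%N -> derive1 (glue J S Delta P) (S j) = (deriv (P j)).[S j].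
Proof.
move=> D0 sep jJ; rewrite derivE !derive1E; apply: near_eq_derive.
near=> x; apply: (glue_inside P sep) => //.
rewrite /window -ler_distl; apply: ltW.
by near: x; exists Delta => //= y /=; rewrite distrC.
Unshelve. all: by end_near. Qed.

Lemma window_node_uniq (R : realType) (delta : R) (i j : nat) (x : R) :
  0 < delta < 1 ->
  window (node delta) ((1 - delta) / 2) i x ->
  window (node delta) ((1 - delta) / 2) j x -> i = j.
Proof.
move=> hd; have /andP[d0 d1] := hd; move=> /andP[i1 i2] /andP[j1 j2].
have [/(node_lt_spread hd) ij|/(node_lt_spread hd) ji|//] := ltngtP i j;
  by exfalso; lra.
Qed.

(** A rejected trial point [x] from the node [k] satisfies
    [gap k / delta <= x - node k <= gap k.+1]: the lower bound keeps it to the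
    right of the window of [k.+1], the upper one to the left of that of [k.+2]. *)
Lemma trial_in_void (R : realType) (delta : R) (k l : nat) :
  0 < delta < 1 -> (l < (2 ^ k).-1)%N ->
  forall j, ~~ window (node delta) ((1 - delta) / 2) j
                 (node delta k + delta ^+ l * gap delta k.+1).
Proof.
move=> hd ll j; have /andP[d0 d1] := hd.
have g1 := gap_ge1 k hd; have g0 := gap_gt0 k.+1 d0.
set t := delta ^+ l * _.
have tub : t <= gap delta k.+1.
  by rewrite /t ler_piMl ?(ltW g0) // exprn_ile1 // ltW.
have tlb : gap delta k <= delta * t.
  rewrite -gap_backtrack // /t mulrA -exprS ler_wpM2r ?(ltW g0) //.
  by rewrite ler_wiXn2l // ltW.
apply/negP => /andP[w1 w2]; have [jk|jk] := leqP j k.+1.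
  by have := node_le hd jk; rewrite nodeS => njk; nra.
by have := node_le hd jk; rewrite !nodeS => njk; lra.
Qed.

(** * The objective function at the nodes *)

Definition height {R : realType} (delta alpha rho : R) (j : nat) : R :=
  - (rho / alpha) * \sum_(0 <= k < j) gap delta k.+1 ^+ 2.

Lemma node_dataE (R : realType) (delta alpha rho : R) (j : nat) :
  node_data delta alpha rho j =
  (height delta alpha rho j, - (gap delta j.+1 / alpha), 0).
Proof.
case: j => [|j].
  by rewrite /height big_nil mulr0 /gap /= expr1 subrr expr0z.
rewrite /node_data /height /gap; congr (_ * _, - (_ ^ _ / _), _).
  apply: eq_bigr => k _; rewrite [RHS]exprnP exprz_exp; congr (_ ^ _).
  by rewrite !expr2z addn2 !expnS; lia.
by rewrite addn1 addn2.
Qed.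

Lemma height_le0 (R : realType) (delta alpha rho : R) (j : nat) :
  0 < alpha -> 0 < rho -> height delta alpha rho j <= 0.
Proof.
move=> a0 r0; rewrite /height mulNr oppr_le0.
rewrite mulr_ge0 ?divr_ge0 ?(ltW a0) ?(ltW r0) //.
by apply: sumr_ge0 => k _; exact: sqr_ge0.
Qed.

(** The interpolating polynomials are not unique; these three properties are
    common to all admissible choices, so that the evaluation count does not
    depend on the choice. *)
Definition landscape {R : realType} (delta alpha rho : R) (J : nat)
    (F : R -> R) : Prop :=
  [/\ forall j, (j <= J)%N -> F (node delta j) = height delta alpha rho j,
      forall j, (j <= J)%N ->
        derive1 F (node delta j) = - (gap delta j.+1 / alpha)
    & forall x, (forall j, ~~ window (node delta) ((1 - delta) / 2) j x) ->
        F x = 0].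

Lemma landscape_glue (R : realType) (delta alpha rho : R) (J : nat)
    (P : nat -> {poly R}) :
  0 < delta < 1 ->
  (forall j : nat, (j <= J)%N ->
     interpolates (node delta j) ((1 - delta) / 2)
       (node_data delta alpha rho j) (P j)) ->
  landscape delta alpha rho J (glue J (node delta) ((1 - delta) / 2) P).
Proof.
move=> hd hP.
have D0 : 0 < (1 - delta) / 2 by lra.
have sep j i y : window (node delta) ((1 - delta) / 2) i y ->
    window (node delta) ((1 - delta) / 2) j y -> i = j.
  exact: window_node_uniq.
split=> [j jJ|j jJ|x out]; last by rewrite glue_outside.
  rewrite (glue_inside P (sep j)) //; last by rewrite /window; lra.
  by have := hP j jJ; rewrite node_dataE => -[_ _ []].
rewrite (derive1_glue P D0 (sep j)) //.
by have := hP j jJ; rewrite node_dataE => -[_ _ []].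
Qed.

(** * The backtracking method on this landscape *)

Section Backtracking.
Context {R : realType} {delta alpha rho : R} {J : nat} {F : R -> R}.
Context (hdelta : 0 < delta < 1) (halpha : 0 < alpha) (hrho : 0 < rho < 1).
Context (hF : landscape delta alpha rho J F).

Lemma trial_node (k l : nat) : (k <= J)%N ->
  trial F alpha delta (node delta k) l =
  node delta k + delta ^+ l * gap delta k.+1.
Proof.
case: hF => _ dF _ kJ; rewrite /trial dF //.
by field; rewrite gt_eqF.
Qed.

Lemma trial_accepted (k : nat) : (k <= J)%N ->
  trial F alpha delta (node delta k) (2 ^ k).-1 = node delta k.+1.
Proof.
by move=> kJ; rewrite trial_node // gap_backtrack //; case/andP: hdelta.
Qed.

Lemma armijo_bound_node (k l : nat) : (k <= J)%N ->
  F (node delta k) - rho * alpha * delta ^+ l * `|derive1 F (node delta k)| ^+ 2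
  = height delta alpha rho k - delta ^+ l * (rho / alpha * gap delta k.+1 ^+ 2).
Proof.
case: hF => Fn dF _ kJ; rewrite Fn // dF // real_normK ?num_real //.
by field; rewrite gt_eqF.
Qed.

(** From [S_k] to [S_(k+1)] the objective drops by
    [rho / alpha * gap k.+1 ^+ 2], and the test requires only a fraction
    [delta ^+ (2 ^ k).-1] of this. *)
Lemma armijo_accepted (k : nat) : (k < J)%N ->
  armijo F alpha delta rho (node delta k) (2 ^ k).-1.
Proof.
move=> kJ; have [d0 d1] := andP hdelta; have [r0 _] := andP hrho.
have [Fn _ _] := hF.
rewrite /armijo trial_accepted ?armijo_bound_node ?(ltnW kJ) // Fn //.
rewrite {1}/height big_nat_recr //= mulrDr -/(height delta alpha rho k).
rewrite mulNr lerD2l lerN2 ler_piMl //.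
  by rewrite mulr_ge0 ?sqr_ge0 // divr_ge0 // ltW.
by rewrite exprn_ile1 // ltW.
Qed.

(** The trial value is [0], while the test requires a value strictly below
    [height k <= 0]. *)
Lemma armijo_rejected (k l : nat) : (k < J)%N -> (l < (2 ^ k).-1)%N ->
  ~ armijo F alpha delta rho (node delta k) l.
Proof.
move=> kJ ll; have [d0 _] := andP hdelta; have [r0 _] := andP hrho.
have [_ _ Fvoid] := hF.
rewrite /armijo armijo_bound_node ?trial_node ?(ltnW kJ) //.
rewrite Fvoid; last exact: trial_in_void.
apply/negP; rewrite -ltNge.
set r := delta ^+ l * _; apply: (@le_lt_trans _ _ (- r)).
  by rewrite gerDr height_le0.
by rewrite oppr_lt0 !mulr_gt0 ?invr_gt0 ?exprn_gt0 ?gap_gt0.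
Qed.

Lemma armijo_run_nodes :
  armijo_run F alpha delta rho 0 J (node delta) (fun k => (2 ^ k).-1).
Proof.
split=> // k kJ; split; [exact: armijo_accepted | | ].
  by move=> l; exact: armijo_rejected.
by rewrite trial_accepted // ltnW.
Qed.

Lemma armijo_run_exponents (theta : nat -> R) (ell : nat -> nat) :
  armijo_run F alpha delta rho 0 J theta ell ->
  forall k, (k < J)%N -> ell k = (2 ^ k).-1.
Proof.
move=> [th0 run].
have ell_node k : (k < J)%N -> theta k = node delta k -> ell k = (2 ^ k).-1.
  move=> kJ thk; have [] := run k kJ; rewrite thk => acc rej _.
  case: (ltngtP (ell k) (2 ^ k).-1) => // lk.
    by case: (armijo_rejected kJ lk).
  by case: (rej _ lk); exact: armijo_accepted.
have th_node k : (k <= J)%N -> theta k = node delta k.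
  elim: k => // k IHk kJ; have [_ _ ->] := run k kJ.
  have thk := IHk (ltnW kJ).
  by rewrite (ell_node k kJ thk) thk (trial_accepted (ltnW kJ)).
by move=> k kJ; exact: ell_node kJ (th_node k (ltnW kJ)).
Qed.

End Backtracking.

Lemma evaluations_doubling (ell : nat -> nat) (j : nat) :
  (forall k, (k < j)%N -> ell k = (2 ^ k).-1) -> evaluations ell j = (2 ^ j)%N.
Proof.
rewrite /evaluations; elim: j => [|j IHj] ellE; first by rewrite big_nil.
rewrite big_nat_recr //= addnA IHj => [|k kj]; last by rewrite ellE // ltnW.
by rewrite ellE // prednK ?expn_gt0 // addnn expnS mul2n.
Qed.

Theorem proposition4p3 (R : realType) (delta alpha rho : R) (J : nat)
    (P : nat -> {poly R})
    (hdelta : 0 < delta < 1) (halpha : 0 < alpha) (hrho : 0 < rho < 1)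
    (hJ : (1 <= J)%N)
    (hP : forall j : nat, (j <= J)%N ->
       interpolates (node delta j) ((1 - delta) / 2)
         (node_data delta alpha rho j) (P j)) :
  let F := glue J (node delta) ((1 - delta) / 2) P in
  (exists (theta : nat -> R) (ell : nat -> nat),
     armijo_run F alpha delta rho 0 J theta ell) /\
  (forall (theta : nat -> R) (ell : nat -> nat),
     armijo_run F alpha delta rho 0 J theta ell ->
     forall j : nat, (1 <= j <= J)%N -> evaluations ell j = (2 ^ j)%N).
Proof.
move=> F; have hF : landscape delta alpha rho J F by exact: landscape_glue.
split.
  exists (node delta), (fun k => (2 ^ k).-1).
  exact: (armijo_run_nodes hdelta halpha hrho hF).
move=> theta ell run j /andP[_ jJ]; apply: evaluations_doubling => k kj.
apply: (armijo_run_exponents hdelta halpha hrho hF run).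
exact: leq_trans jJ.
Qed.
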